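(* Let $\omega(x,y,z) = xyz + zyx$ (the Jordan family, $q=\infty$). Then: (i) a basis of $U(A^\omega)$ consists of $1, a, b, ab, ba$; (ii) the structure constants are $a\cdot b = ab$, $a\cdot ba = a$, $b\cdot a = ba$, $b\cdot ab = b$, $ab\cdot a = a$, $ab\cdot ab = ab$, $ba\cdot b = b$, $ba\cdot ba = ba$, where all products of two basis elements different from $1$ that are not listed are $0$; (iii) the Wedderburn decomposition is $U(A^\omega) \cong \mathbb{F} \oplus M_2(\mathbb{F})$ (direct sum of simple two-sided ideals); (iv) up to isomorphism, the only finite dimensional irreducible representations of $U(A^\omega)$ are the trivial 1-dimensional representation ($a,b\mapsto 0$) and the natural 2-dimensional representation ($a\mapsto e_1$, $b\mapsto e_2$).
   Context: $\mathbb{F}$ is a field of characteristic $0$. $A$ is the 2-dimensional space of $2\times 2$ matrices over $\mathbb{F}$ with zero diagonal, with basis $e_1 = \begin{bmatrix} 0&1\\0&0\end{bmatrix}$, $e_2 = \begin{bmatrix} 0&0\\1&0\end{bmatrix}$; it is closed under triple products $xyz$ of matrices. For a trilinear operation $\omega(x,y,z)$ (a fixed rational linear combination of the six products of $x,y,z$ in all orders), $A^\omega$ denotes the space $A$ with the trilinear operation $\omega$ computed using matrix multiplication. Let $\mathbb{F}\langle a,b\rangle$ be the free unital associative algebra and $\phi\colon A \to \mathbb{F}\langle a,b\rangle$ the linear map with $\phi(e_1)=a$, $\phi(e_2)=b$. The universal associative envelope is $U(A^\omega) = \mathbb{F}\langle a,b\rangle / I$, where $I$ is the two-sided ideal generated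 by the elements $\omega(\phi(x),\phi(y),\phi(z)) - \phi(\omega(x,y,z))$ for $x,y,z\in\{e_1,e_2\}$. The cosets of $a,b$ in $U(A^\omega)$ are again written $a,b$. Representations of $U(A^\omega)$ are unital algebra homomorphisms to endomorphism algebras. *)

(* Defs.v *)
From HB Require Import structures.
From mathcomp Require Import all_boot all_algebra.
From mathcomp Require Import boolp.
From mathcomp Require Import monalg.

Set Implicit Arguments.
Unset Strict Implicit.
Unset Printing Implicit Defensive.

Import GRing.Theory.
Local Open Scope ring_scope.
Local Open Scope quotient_scope.

Section Ideals.
Variable R : pzRingType.

Definition is_ideal (J : R -> Prop) : Prop :=
  [/\ J 0,
      forall x y, J x -> J y -> J (x + y),
      forall r x, J x -> J (r * x)
    & forall x r, J x -> J (x * r)].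

Definition gen_ideal (S : R -> Prop) (x : R) : Prop :=
  forall J : R -> Prop, is_ideal J -> (forall s, S s -> J s) -> J x.

Lemma gen_ideal_is_ideal (S : R -> Prop) : is_ideal (gen_ideal S).
Proof.
split=> [J HJ _|x y Sx Sy J HJ SJ|r x Sx J HJ SJ|x r Sx J HJ SJ].
- by case: HJ.
- by case: (HJ) => _ JD _ _; apply: JD; [apply: Sx | apply: Sy].
- by case: (HJ) => _ _ Jl _; apply: Jl; apply: Sx.
- by case: (HJ) => _ _ _ Jr; apply: Jr; apply: Sx.
Qed.

Definition direct_sum_decomposition (J1 J2 : R -> Prop) : Prop :=
  (forall x, exists x1 x2, [/\ J1 x1, J2 x2 & x = x1 + x2])
  /\ (forall x, J1 x -> J2 x -> x = 0).

End Ideals.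

(* J, with the operations of A, is a simple algebra: its multiplication is
   not zero, and its only two-sided ideals, as an algebra in its own right,
   are 0 and J. *)
Definition simple_ideal (F : fieldType) (A : algType F) (J : A -> Prop) : Prop :=
  [/\ is_ideal J,
      exists x y, [/\ J x, J y & x * y <> 0]
    & forall K : A -> Prop,
        (forall x, K x -> J x) ->
        K 0 ->
        (forall (k : F) x y, K x -> K y -> K (k *: x + y)) ->
        (forall j x, J j -> K x -> K (j * x) /\ K (x * j)) ->
        (forall x, K x -> x = 0) \/ (forall x, J x -> K x)].

Definition is_basis (F : fieldType) (V : lmodType F) (n : nat)
    (v : n.-tuple V) : Prop :=
  (forall c : 'I_n -> F,
      \sum_i c i *: tnth v i = 0 -> forall i, c i = 0)
  /\ (forall u : V, exists c : 'I_n -> F, u = \sum_i c i *: tnth v i).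

Section Representations.
Variables (F : fieldType) (A : algType F).

Definition is_representation (V : vectType F) (rho : {linear A -> 'End(V)}) :
    Prop :=
  rho 1 = \1%VF /\ forall x y, rho (x * y) = (rho x \o rho y)%VF.

Definition irreducible (V : vectType F) (rho : {linear A -> 'End(V)}) : Prop :=
  (fullv != 0%VS :> {vspace V}) /\
  forall W : {vspace V}, (forall x, (rho x @: W <= W)%VS) ->
    W = 0%VS \/ W = fullv.

Definition isomorphic_reps (V W : vectType F)
    (rho : {linear A -> 'End(V)}) (sigma : {linear A -> 'End(W)}) : Prop :=
  exists f : 'Hom(V, W),
    bijective f /\ forall x v, f (rho x v) = sigma x (f v).

End Representations.

(* The same ternary operation is used on matrices and on the free algebra. *)
Definition jordan (R : pzRingType) (x y z : R) : R := x * y * z + z * y * x.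

Lemma jordan_ker (R S : pzRingType) (f : {rmorphism R -> S}) (x y z : R) :
  f z = 0 -> f (jordan x y z) = 0.
Proof. by move=> fz; rewrite rmorphD !rmorphM fz mulr0 !mul0r addr0. Qed.

Section ZeroDiagonal.
Variable F : fieldType.

Definition zero_diag : {pred 'M[F]_2} := fun M => [forall i, M i i == 0].

Lemma zero_diagP (M : 'M[F]_2) :
  reflect (forall i, M i i = 0) (M \in zero_diag).
Proof. exact: 'forall_eqP. Qed.

Lemma zero_diag_submod : submod_closed zero_diag.
Proof.
split=> [|k M N /zero_diagP HM /zero_diagP HN]; apply/zero_diagP => i.
  by rewrite mxE.
by rewrite !mxE HM HN mulr0 addr0.
Qed.
HB.instance Definition _ :=
  GRing.isSubmodClosed.Build F 'M[F]_2 zero_diag zero_diag_submod.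

Record zdmx : predArgType := Zdmx {
  zdval :> 'M[F]_2;
  zdvalP : zdval \in zero_diag
}.
HB.instance Definition _ := [isSub for zdval].
HB.instance Definition _ := [Choice of zdmx by <:].
HB.instance Definition _ := [SubChoice_isSubZmodule of zdmx by <:].
HB.instance Definition _ := [SubZmodule_isSubLmodule of zdmx by <:].

Lemma zero_diag_mul3 (x y z : 'M[F]_2) :
  x \in zero_diag -> y \in zero_diag -> z \in zero_diag ->
  x * y * z \in zero_diag.
Proof.
move=> /zero_diagP hx /zero_diagP hy /zero_diagP hz; apply/zero_diagP => i.
have E (M N : 'M[F]_2) j k : (M * N) j k = M j 0 * N 0 k + M j 1 * N 1 k.
  by rewrite mxE !big_ord_recl big_ord0 addr0; congr (_ + M _ _ * N _ _);
    apply: val_inj.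
have [->|->] : i = 0 \/ i = 1.
  by case: i => [[|[|//]]] ?; [left|right]; apply: val_inj.
all: by rewrite !E !hx !hy !hz !(mul0r, mulr0, add0r, addr0).
Qed.

Lemma zero_diag_jordan (x y z : zdmx) :
  jordan (zdval x) (zdval y) (zdval z) \in zero_diag.
Proof. by apply: rpredD; apply: zero_diag_mul3; apply: zdvalP. Qed.

Definition zd_jordan (x y z : zdmx) : zdmx := Zdmx (zero_diag_jordan x y z).

Lemma delta_zero_diag (i j : 'I_2) : i != j -> delta_mx i j \in zero_diag.
Proof.
move=> ij; apply/zero_diagP => k; rewrite mxE.
by case: eqP => [->|//]; rewrite (negPf ij).
Qed.

Definition e1 : zdmx := Zdmx (@delta_zero_diag 0 1 isT).
Definition e2 : zdmx := Zdmx (@delta_zero_diag 1 0 isT).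

End ZeroDiagonal.

(* The library only gives a ring structure to quotients of commutative rings. *)
Section QuotientAlgebra.
Variables (F : fieldType) (A : lalgType F) (I : zmodClosed A).
Hypotheses (IMl : forall r x : A, x \in I -> r * x \in I)
           (IMr : forall x r : A, x \in I -> x * r \in I)
           (I1 : 1 \notin I)
           (scaleAr : forall (k : F) (x y : A), k *: (x * y) = x * (k *: y)).

Local Notation Q := (Quotient.quot I).

Definition quot_one : Q := lift_cst Q 1.
Definition quot_mul := lift_op2 Q *%R.
Definition quot_scale (k : F) := lift_op1 Q ( *:%R k).

Lemma quot_pi_eq (x y : A) : x - y \in I -> \pi_Q x = \pi_Q y.
Proof. by rewrite Quotient.idealrBE => /eqP. Qed.

Lemma quot_repr (x : A) : x - repr (\pi_Q x) \in I.
Proof. by rewrite Quotient.idealrBE reprK. Qed.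

Lemma quot_mulE : {morph \pi_Q : x y / x * y >-> quot_mul x y}.
Proof.
move=> x y; unlock quot_mul; apply: quot_pi_eq.
rewrite -[x * y](subrK (x * repr (\pi_Q y))) -mulrBr -addrA -mulrBl.
by apply: rpredD; [apply/IMl/quot_repr | apply/IMr/quot_repr].
Qed.

Lemma quot_scaleE k : {morph \pi_Q : x / k *: x >-> quot_scale k x}.
Proof.
move=> x; unlock quot_scale; apply: quot_pi_eq.
by rewrite -scalerBr -[_ - _]mul1r scalerAl; apply/IMl/quot_repr.
Qed.

Lemma quot_oneE : \pi_Q 1 = quot_one.
Proof. by unlock quot_one. Qed.

Lemma quot_addE : {morph \pi_Q : x y / x + y}.
Proof. exact: raddfD. Qed.

Lemma quot_mulA : associative quot_mul.
Proof.
by elim/quotW=> x; elim/quotW=> y; elim/quotW=> z; rewrite -!quot_mulE mulrA.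
Qed.

Lemma quot_mul1q : left_id quot_one quot_mul.
Proof. by elim/quotW=> x; rewrite -quot_oneE -quot_mulE mul1r. Qed.

Lemma quot_mulq1 : right_id quot_one quot_mul.
Proof. by elim/quotW=> x; rewrite -quot_oneE -quot_mulE mulr1. Qed.

Lemma quot_mulDl : left_distributive quot_mul +%R.
Proof.
elim/quotW=> x; elim/quotW=> y; elim/quotW=> z.
by rewrite -quot_addE -!quot_mulE -quot_addE mulrDl.
Qed.

Lemma quot_mulDr : right_distributive quot_mul +%R.
Proof.
elim/quotW=> x; elim/quotW=> y; elim/quotW=> z.
by rewrite -quot_addE -!quot_mulE -quot_addE mulrDr.
Qed.

Lemma quot_one_neq0 : quot_one != 0.
Proof.
apply: contra I1 => /eqP; rewrite -quot_oneE -[0](raddf0 \pi_Q) => /eqP.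
by rewrite -Quotient.idealrBE subr0.
Qed.

Lemma quot_scaleA a b x : quot_scale a (quot_scale b x) = quot_scale (a * b) x.
Proof. by elim/quotW: x => x; rewrite -!quot_scaleE scalerA. Qed.

Lemma quot_scale1 : left_id 1 quot_scale.
Proof. by elim/quotW=> x; rewrite -quot_scaleE scale1r. Qed.

Lemma quot_scaleDr : right_distributive quot_scale +%R.
Proof.
move=> k; elim/quotW=> x; elim/quotW=> y.
by rewrite -quot_addE -!quot_scaleE -quot_addE scalerDr.
Qed.

Lemma quot_scaleDl x : {morph quot_scale^~ x : a b / a + b}.
Proof.
elim/quotW: x => x a b.
by rewrite -!quot_scaleE -quot_addE scalerDl.
Qed.

Lemma quot_scaleAl k x y :
  quot_scale k (quot_mul x y) = quot_mul (quot_scale k x) y.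
Proof.
elim/quotW: x => x; elim/quotW: y => y.
by rewrite -quot_mulE -!quot_scaleE -quot_mulE scalerAl.
Qed.

Lemma quot_scaleAr k x y :
  quot_scale k (quot_mul x y) = quot_mul x (quot_scale k y).
Proof.
elim/quotW: x => x; elim/quotW: y => y.
by rewrite -quot_mulE -!quot_scaleE -quot_mulE scaleAr.
Qed.

End QuotientAlgebra.

(* F<a, b> is the algebra, over F, of the free monoid on two letters. *)
Notation free2 F := {malg F[{fmonom 'I_2}]}.

Section Envelope.
Variable F : fieldType.

Definition fa : free2 F := << fmu 0 >>.
Definition fb : free2 F := << fmu 1 >>.

Lemma free2_scaleAr (k : F) (x y : free2 F) : k *: (x * y) = x * (k *: y).
Proof.
apply/malgP => m.
rewrite mcoeffZ mcoeffMl (mcoeffMlw m (finmap.fsubset_refl _) (msuppZ_le k y)).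
rewrite mulr_sumr; apply: eq_bigr => m1 _.
rewrite mulr_sumr; apply: eq_bigr => m2 _.
by rewrite mcoeffZ mulrnAr mulrCA.
Qed.

Definition phi (x : zdmx F) : free2 F := zdval x 0 1 *: fa + zdval x 1 0 *: fb.

Fact lin_comb2 (V : lmodType F) (u v : V) (k a1 b1 a2 b2 : F) :
  (k * a1 + b1) *: u + (k * a2 + b2) *: v =
  k *: (a1 *: u + a2 *: v) + (b1 *: u + b2 *: v).
Proof. by rewrite !scalerDl scalerDr !scalerA addrACA. Qed.

Lemma phi_linear : linear phi.
Proof.
move=> k x y; have E i j :
  zdval (k *: x + y) i j = k * zdval x i j + zdval y i j by rewrite !mxE.
rewrite /phi.
rewrite (E 0 1).
rewrite (E 1 0).
apply: lin_comb2.
Qed.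
HB.instance Definition _ := GRing.isLinear.Build F (zdmx F) (free2 F) *:%R phi
  phi_linear.

Lemma phi_e1 : phi (e1 F) = fa.
Proof. by rewrite /phi /= !mxE /= scale1r scale0r addr0. Qed.

Lemma phi_e2 : phi (e2 F) = fb.
Proof. by rewrite /phi /= !mxE /= scale1r scale0r add0r. Qed.

Inductive env_relator : free2 F -> Prop :=
  EnvRelator x y z of x \in [:: e1 F; e2 F] & y \in [:: e1 F; e2 F]
      & z \in [:: e1 F; e2 F] :
    env_relator (jordan (phi x) (phi y) (phi z) - phi (zd_jordan x y z)).

(* Classical, since the quotient construction wants a boolean predicate. *)
Definition env_ideal : {pred free2 F} := fun x => `[< gen_ideal env_relator x >].

Lemma env_ideal_is_ideal : is_ideal (fun x => x \in env_ideal).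
Proof.
have [I0 ID Il Ir] := gen_ideal_is_ideal env_relator.
split=> [|x y /asboolP Ix /asboolP Iy|r x /asboolP Ix|x r /asboolP Ix];
  apply/asboolP; [exact: I0 | exact: ID | exact: Il | exact: Ir].
Qed.

Lemma env_ideal_zmod_closed : zmod_closed env_ideal.
Proof.
have [I0 ID Il _] := env_ideal_is_ideal.
by split=> // x y Ix Iy; apply: ID => //; rewrite -mulN1r; apply: Il.
Qed.
HB.instance Definition _ :=
  GRing.isZmodClosed.Build (free2 F) env_ideal env_ideal_zmod_closed.

Lemma env_idealMl (r x : free2 F) : x \in env_ideal -> r * x \in env_ideal.
Proof. by have [_ _ Il _] := env_ideal_is_ideal; apply: Il. Qed.

Lemma env_idealMr (x r : free2 F) : x \in env_ideal -> x * r \in env_ideal.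
Proof. by have [_ _ _ Ir] := env_ideal_is_ideal; apply: Ir. Qed.

(* The constant term annihilates the relators, so the ideal is proper. *)
Lemma env_ideal1 : 1 \notin env_ideal.
Proof.
pose c : free2 F -> F := mcoeff (@mone {fmonom 'I_2}).
have cD x y : c (x + y) = c x + c y by apply: mcoeffD.
have cM x y : c (x * y) = c x * c y.
  exact: (rmorphM (mcoeff (@mone {fmonom 'I_2}) : {rmorphism {malg F[_]} -> F})).
have c1 : c 1 = 1 by rewrite /c mcoeff1 eqxx.
have cphi x : c (phi x) = 0.
  have c0 (k : F) (i : 'I_2) : c (k *: << fmu i >>) = 0.
    by rewrite /c mcoeffZ mcoeffU1 -val_eqE /= fmU fm1 mulr0.
  by rewrite /phi cD -[RHS]addr0; congr (_ + _); apply: c0.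
apply/negP => /asboolP /(_ (fun x => c x = 0)); rewrite c1.
move=> H; suff: 1 = 0 :> F by move/eqP; rewrite oner_eq0.
apply: H.
  split=> [|x y cx cy|r x cx|x r cx]; first exact: mcoeff0.
  - by rewrite cD cx cy addr0.
  - by rewrite cM cx mulr0.
  - by rewrite cM cx mul0r.
move=> _ [x y z _ _ _].
have cN u : c (- u) = - c u by apply: mcoeffN.
rewrite cD cN cphi (_ : c (jordan _ _ _) = 0) ?subr0 //.
exact: (@jordan_ker (free2 F) F (mcoeff (@mone {fmonom 'I_2}))).
Qed.

Definition envelope : Type := Quotient.quot (env_ideal : zmodClosed (free2 F)).
HB.instance Definition _ := Choice.on envelope.
HB.instance Definition _ := GRing.Zmodule.on envelope.

HB.instance Definition _ := GRing.Zmodule_isNzRing.Build envelope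
  (quot_mulA env_idealMl env_idealMr) (quot_mul1q env_idealMl env_idealMr)
  (quot_mulq1 env_idealMl env_idealMr) (quot_mulDl env_idealMl env_idealMr)
  (quot_mulDr env_idealMl env_idealMr) (quot_one_neq0 env_ideal1).
HB.instance Definition _ := GRing.Zmodule_isLmodule.Build F envelope
  (quot_scaleA env_idealMl) (quot_scale1 env_idealMl)
  (quot_scaleDr env_idealMl) (quot_scaleDl env_idealMl).
HB.instance Definition _ := GRing.Lmodule_isLalgebra.Build F envelope
  (quot_scaleAl env_idealMl env_idealMr).
HB.instance Definition _ := GRing.Lalgebra_isAlgebra.Build F envelope
  (quot_scaleAr env_idealMl env_idealMr free2_scaleAr).

Definition env_proj (x : free2 F) : envelope :=
  \pi_(Quotient.quot (env_ideal : zmodClosed (free2 F))) x.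

Lemma env_proj_linear : linear env_proj.
Proof.
move=> k x y; rewrite /env_proj quot_addE (quot_scaleE env_idealMl) //.
Qed.
HB.instance Definition _ :=
  GRing.isLinear.Build F (free2 F) envelope *:%R env_proj env_proj_linear.

Lemma env_proj_monoid : monoid_morphism env_proj.
Proof.
split; first exact: quot_oneE.
by move=> x y; rewrite /env_proj (quot_mulE env_idealMl env_idealMr).
Qed.
HB.instance Definition _ :=
  GRing.isMonoidMorphism.Build (free2 F) envelope env_proj env_proj_monoid.

Lemma env_proj_surj (u : envelope) : exists x, env_proj x = u.
Proof. by elim/quotW: u => x; exists x. Qed.

Lemma env_proj_eq0 (x : free2 F) :
  (env_proj x = 0) <-> gen_ideal env_relator x.
Proof.
rewrite -[0](raddf0 env_proj); split=> [/eqP|H].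
  by rewrite /env_proj -Quotient.idealrBE subr0 => /asboolP.
by apply/eqP; rewrite /env_proj -Quotient.idealrBE subr0; apply/asboolP.
Qed.

Definition env_a : envelope := env_proj fa.
Definition env_b : envelope := env_proj fb.

End Envelope.

(* Main.v *)
Require Import Defs.
From HB Require Import structures.
From mathcomp Require Import all_boot all_algebra.
From mathcomp Require Import boolp monalg.
Import GRing.Theory.
Local Open Scope ring_scope.

Set Implicit Arguments.
Unset Strict Implicit.
Unset Printing Implicit Defensive.

(* The relators say [aba = a], [bab = b], [aaa = bbb = 0], [aab = - baa] and
   [bba = - abb], the first four after division by 2.  Then
   [aa = a(aba) = (aab)a = - b(aaa) = 0], likewise [bb = 0], so the envelope is
   spanned by [1, a, b, ab, ba].  Sending [a] and [b] to [(0, e1)] and [(0, e2)]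
   kills the relators, and the induced morphism to [F * 'M_2] carries
   [1 - ab - ba, ab, a, b, ba] to the unit of [F] and the matrix units of
   ['M_2], hence is an isomorphism.  The rest holds for any algebra [F * 'M_n].
   In an irreducible representation, either [(0, c r) v <> 0] for some column
   [c], row [r] and vector [v], and then [c |-> (0, c r) v] is an isomorphism
   from the column vectors by Schur's lemma, or all of ['M_n] acts by 0 and the
   algebra acts by scalars. *)

(** * Evaluation morphisms out of the free algebra *)

Section FreeAlgebraMorphism.
Variables (F : fieldType) (S : algType F) (s : 'I_2 -> S).

Definition word_eval (m : {fmonom 'I_2}) : S := \prod_(i <- m) s i.

Lemma word_eval_mmorphism : mmorphism word_eval.
Proof. by split=> [m n|]; rewrite /word_eval (fmM, fm1) (big_cat, big_nil). Qed.
HB.instance Definition _ :=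
  monalg.isMultiplicative.Build {fmonom 'I_2} S word_eval word_eval_mmorphism.

Definition free2_eval : free2 F -> S := mmap (in_alg S) word_eval.

Lemma free2_eval_linear : linear free2_eval.
Proof.
move=> k x y; rewrite /free2_eval raddfD /= mmapZ.
by rewrite mulr_algl.
Qed.
HB.instance Definition _ :=
  GRing.isLinear.Build F (free2 F) S *:%R free2_eval free2_eval_linear.

(** The target need not be commutative; multiplicativity rests on the images of the coefficients
    being central in [S]. *)
Lemma free2_eval_monoid_morphism : monoid_morphism free2_eval.
Proof.
have [fM f1] := @commr_mmap_is_multiplicative _ _ _ (in_alg S) word_eval
  (fun _ _ _ => comm_alg _ _).
by split.
Qed.
HB.instance Definition _ := GRing.isMonoidMorphism.Build (free2 F) S free2_eval
  free2_eval_monoid_morphism.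

Lemma free2_evalU i : free2_eval << fmu i >> = s i.
Proof.
by rewrite /free2_eval mmapU /= scale1r mul1r /word_eval fmU big_seq1.
Qed.

End FreeAlgebraMorphism.

(** * Induction on words in the free algebra and in the envelope *)

Lemma malgUM (K : monomType) (R : nzRingType) (k l : K) :
  << k >> * << l >> = << mmul k l >> :> {malg R[K]}.
Proof.
by rewrite malgME !msuppU1 !finmap.big_seq_fset1 !mcoeffUU mulr1.
Qed.

Lemma malgUZ (K : choiceType) (R : nzRingType) (c : R) (k : K) :
  << c *g k >> = c *: << k >> :> {malg R[K]}.
Proof. by apply/malgP => l; rewrite mcoeffZ !mcoeffU mulrnAr mulr1. Qed.

Lemma ord2P (i : 'I_2) : i = 0 \/ i = 1.
Proof. by case: i => [[|[|//]]] ?; [left | right]; apply: val_inj. Qed.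

Lemma free2_ind (F : fieldType) (P : free2 F -> Prop) :
  P 1 ->
  (forall k x y, P x -> P y -> P (k *: x + y)) ->
  (forall x, P x -> P (fa F * x)) ->
  (forall x, P x -> P (fb F * x)) ->
  forall x, P x.
Proof.
move=> P1 PD Pa Pb x.
(* Zero is obtained as [(-1) *: 1 + 1]; it starts the sum over the support of [x]. *)
have P0 : P 0 by rewrite -(addNr 1) -scaleN1r; apply: PD.
have PU (m : {fmonom 'I_2}) : P << m >>.
  case: m; elim=> [|i m IHm]; first by rewrite -fmoneE.
  have -> : FMonom (i :: m) = mmul (fmu i) (FMonom m).
    by apply/eqP; rewrite fmP fmM fmU.
  rewrite -malgUM.
  by case: (ord2P i) => ->; [apply: Pa | apply: Pb].
rewrite (monalgE x); elim: (finmap.enum_fset _) => [|m r IHr].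
  by rewrite big_nil.
by rewrite big_cons malgUZ; apply: PD.
Qed.

(** Words grow by prefixing a letter, so a linear property of the envelope only has to be checked at
    [1] and under left multiplication by the generators. *)
Lemma envelope_ind (F : fieldType) (P : envelope F -> Prop) :
  P 1 ->
  (forall k x y, P x -> P y -> P (k *: x + y)) ->
  (forall x, P x -> P (env_a F * x)) ->
  (forall x, P x -> P (env_b F * x)) ->
  forall u, P u.
Proof.
move=> P1 PD Pa Pb u; have [x <-] := env_proj_surj u.
elim/free2_ind: x => [|k x y Px Py|x Px|x Px].
- by rewrite rmorph1.
- by rewrite linearP; apply: PD.
- by rewrite rmorphM; apply: Pa.
- by rewrite rmorphM; apply: Pb.
Qed.

(** * The universal property of the envelope *)

Lemma is_ideal_ker (R S : pzRingType) (h : {rmorphism R -> S}) :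
  is_ideal (fun x => h x = 0).
Proof.
split=> [|x y hx hy|r x hx|x r hx]; first exact: rmorph0.
- by rewrite rmorphD hx hy addr0.
- by rewrite rmorphM hx mulr0.
- by rewrite rmorphM hx mul0r.
Qed.

Section EnvelopeLift.
Variables (F : fieldType) (S : algType F) (h : {lrmorphism free2 F -> S}).
Hypothesis h_relator : forall x, env_relator x -> h x = 0.

Definition env_lift (u : envelope F) : S := h (repr u).

(** Independence of the chosen representative: [x] differs from it by an element of the ideal
    generated by the relators, which lies in the kernel of [h]. *)
Lemma env_liftE x : env_lift (env_proj x) = h x.
Proof.
have /asboolP/(_ _ (is_ideal_ker h) h_relator) :=
  @quot_repr _ _ (@env_ideal F) x.
by move/eqP; rewrite raddfB /= subr_eq0 => /eqP.
Qed.

Lemma env_lift_linear : linear env_lift.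
Proof.
move=> k u v; have [x <-] := env_proj_surj u; have [y <-] := env_proj_surj v.
by rewrite -linearP !env_liftE linearP.
Qed.
HB.instance Definition _ :=
  GRing.isLinear.Build F (envelope F) S *:%R env_lift env_lift_linear.

Lemma env_lift_monoid_morphism : monoid_morphism env_lift.
Proof.
split=> [|u v]; first by rewrite -(rmorph1 (@env_proj F)) env_liftE rmorph1.
have [x <-] := env_proj_surj u; have [y <-] := env_proj_surj v.
by rewrite -rmorphM !env_liftE rmorphM.
Qed.
HB.instance Definition _ := GRing.isMonoidMorphism.Build (envelope F) S env_lift
  env_lift_monoid_morphism.

End EnvelopeLift.

(** * Relations between the generators of the envelope *)

Lemma rmorph_jordan (R S : pzRingType) (f : {rmorphism R -> S}) (x y z : R) :
  f (jordan x y z) = jordan (f x) (f y) (f z).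
Proof. by rewrite /jordan rmorphD !rmorphM. Qed.

Section JordanRelations.
Variables (F : fieldType) (A : algType F) (a b : A).
Hypothesis charF : [pchar F] =i pred0.

(** Characteristic 0 enters the proof here, to make 2 invertible. *)
Lemma double_inj (V : lmodType F) (x y : V) : x *+ 2 = y *+ 2 -> x = y.
Proof.
have two0 : 2%:R != 0 :> F by rewrite (pcharf0P _).1.
by rewrite -!scaler_nat => /(scalerI two0).
Qed.

Lemma jordan_xyx : jordan a b a = a *+ 2 -> a * b * a = a.
Proof. by rewrite /jordan -mulr2n => /double_inj. Qed.

(* [a a = a (a b a) = (a a b) a = - b a a a = 0] *)
Lemma jordan_xx : jordan a a a = 0 -> jordan a a b = 0 ->
  jordan a b a = a *+ 2 -> a * a = 0.
Proof.
rewrite {1 2}/jordan => aaa /eqP; rewrite addr_eq0 => /eqP aab /jordan_xyx aba.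
have a3 : a * a * a = 0 by apply: double_inj; rewrite mul0rn mulr2n.
by rewrite -{2}aba !mulrA aab mulNr -!mulrA [a * (a * a)]mulrA a3 mulr0 oppr0.
Qed.

End JordanRelations.

Section EnvelopeRelations.
Variable F : fieldType.
Local Notation a := (env_a F).
Local Notation b := (env_b F).

Lemma env_jordan x y z :
  x \in [:: e1 F; e2 F] -> y \in [:: e1 F; e2 F] -> z \in [:: e1 F; e2 F] ->
  jordan (env_proj (phi x)) (env_proj (phi y)) (env_proj (phi z)) =
  env_proj (phi (zd_jordan x y z)).
Proof.
move=> xe ye ze; rewrite -(rmorph_jordan (@env_proj F)).
apply/eqP; rewrite -subr_eq0 -(raddfB (@env_proj F)); apply/eqP/env_proj_eq0.
by move=> J _; apply; apply: EnvRelator.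
Qed.

(** The operation is invariant under reversing its three arguments, so these six of the eight
    triples of basis elements account for all relators. *)
Lemma phi_zd_jordan :
  [/\ phi (zd_jordan (e1 F) (e1 F) (e1 F)) = 0,
      phi (zd_jordan (e1 F) (e1 F) (e2 F)) = 0
    & phi (zd_jordan (e1 F) (e2 F) (e1 F)) = fa F *+ 2] /\
  [/\ phi (zd_jordan (e2 F) (e2 F) (e2 F)) = 0,
      phi (zd_jordan (e2 F) (e2 F) (e1 F)) = 0
    & phi (zd_jordan (e2 F) (e1 F) (e2 F)) = fb F *+ 2].
Proof.
have phiE x y z (M := jordan (zdval x) (zdval y) (zdval z)) :
  phi (zd_jordan x y z) = M 0 1 *: fa F + M 1 0 *: fb F by [].
split; split; rewrite phiE /jordan /= -!mulmxE.
all: do 2!rewrite ?mul_delta_mx_cond ?mul0mx /= ?mulr0n ?mulr1n.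
all: rewrite !mxE /=.
all: by rewrite ?addr0 ?add0r !scale0r ?addr0 ?add0r // -mulr2n scaler_nat.
Qed.

Lemma env_jordan_relations :
  [/\ jordan a a a = 0, jordan a a b = 0 & jordan a b a = a *+ 2] /\
  [/\ jordan b b b = 0, jordan b b a = 0 & jordan b a b = b *+ 2].
Proof.
have e1_in : e1 F \in [:: e1 F; e2 F] by rewrite !inE eqxx.
have e2_in : e2 F \in [:: e1 F; e2 F] by rewrite !inE eqxx orbT.
have [[E1 E2 E3] [E4 E5 E6]] := phi_zd_jordan.
have := (env_jordan e1_in e1_in e1_in, env_jordan e1_in e1_in e2_in,
  env_jordan e1_in e2_in e1_in, env_jordan e2_in e2_in e2_in,
  env_jordan e2_in e2_in e1_in, env_jordan e2_in e1_in e2_in).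
rewrite E1 E2 E3 E4 E5 E6 phi_e1 phi_e2 !(raddfMn (@env_proj F)).
rewrite (raddf0 (@env_proj F)).
by case=> [[[[[? ?] ?] ?] ?] ?].
Qed.

End EnvelopeRelations.

(** * Matrix units built from the generators *)

Lemma mulmx2E (R : nzRingType) (M N : 'M[R]_2) i k :
  (M * N) i k = M i 0 * N 0 k + M i 1 * N 1 k.
Proof.
rewrite mxE !big_ord_recl big_ord0 addr0.
by congr (_ + M _ _ * N _ _); apply: val_inj.
Qed.

Lemma mx2P (R : Type) (M N : 'M[R]_2) :
  M 0 0 = N 0 0 -> M 0 1 = N 0 1 -> M 1 0 = N 1 0 -> M 1 1 = N 1 1 -> M = N.
Proof.
move=> E00 E01 E10 E11; apply/matrixP => i j.
by case: (ord2P i) => ->; case: (ord2P j) => ->.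
Qed.

Section MatrixUnits.
Variables (F : fieldType) (A : algType F) (a b : A).
Hypotheses (aa : a * a = 0) (bb : b * b = 0).
Hypotheses (aba : a * b * a = a) (bab : b * a * b = b).

Lemma letter_mulE :
  [/\ a * a = 0, a * b = a * b, a * (a * b) = 0 & a * (b * a) = a] /\
  [/\ b * a = b * a, b * b = 0, b * (a * b) = b & b * (b * a) = 0].
Proof. by split; split; rewrite // mulrA ?aa ?bb ?mul0r. Qed.

(** After reassociation each product either contains the square of a letter, and vanishes, or
    shortens by [aba] or [bab]. *)
Lemma word2_mulE :
  [/\ (a * b) * a = a, (a * b) * b = 0,
      (a * b) * (a * b) = a * b & (a * b) * (b * a) = 0] /\
  [/\ (b * a) * a = 0, (b * a) * b = b,
      (b * a) * (a * b) = 0 & (b * a) * (b * a) = b * a].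
Proof.
have abb : a * b * b = 0 by rewrite -mulrA bb mulr0.
have baa : b * a * a = 0 by rewrite -mulrA aa mulr0.
by split; split; rewrite ?mulrA ?(aba, bab, abb, baa) ?mul0r.
Qed.

(* [1 - a b - b a] is the unit of the summand [F], and [a b], [a], [b], [b a]
   are the matrix units of the summand ['M_2]. *)
Definition units_comb (p : F^o * 'M[F]_2) : A :=
  p.1 *: (1 - a * b - b * a)
  + (p.2 0 0 *: (a * b) + p.2 0 1 *: a + (p.2 1 0 *: b + p.2 1 1 *: (b * a))).

Lemma units_comb_linear : linear units_comb.
Proof.
move=> k p q; rewrite /units_comb !mxE -[(k *: p + q).1]/(k * p.1 + q.1).
set u := 1 - _ - _; clearbody u.
have E (x y : F) (w : A) : (k * x + y) *: w = k *: (x *: w) + y *: w.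
  by rewrite scalerDl scalerA.
rewrite !E !(scalerDr k) [RHS]addrACA; congr (_ + _); rewrite [RHS]addrACA.
by congr (_ + _); rewrite addrACA.
Qed.
HB.instance Definition _ := GRing.isLinear.Build F (F^o * 'M[F]_2)%type A *:%R
  units_comb units_comb_linear.

(** Both letters annihilate [1 - a * b - b * a]; on the other four elements they act as matrix
    units, moving one row of coefficients to the other and killing the rest. This is the inductive
    step of [env_splitK]. *)
Lemma units_comb_mull p :
  a * units_comb p = units_comb ((0, delta_mx 0 1) * p) /\
  b * units_comb p = units_comb ((0, delta_mx 1 0) * p).
Proof.
have [[_ _ aab aba'] [_ _ bab' bba]] := letter_mulE.
split; rewrite /units_comb /= !mul0r !scale0r add0r !mulmx2E !mxE /=.
all: rewrite !mulrDr -!scalerAr !mulrBr mulr1.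
- rewrite aa aab aba' subr0 subrr !scaler0 !add0r.
  by rewrite !mul0r !mul1r ?addr0 ?add0r !scale0r ?addr0 ?add0r.
- rewrite bb bab' bba subrr subr0 !scaler0 !addr0 !add0r.
  by rewrite !mul0r !mul1r ?addr0 ?add0r !scale0r ?addr0 ?add0r.
Qed.

Lemma units_comb1 : units_comb 1 = 1.
Proof.
rewrite /units_comb /= !mxE /= !scale1r !scale0r addr0 add0r.
by rewrite [a * b + _]addrC addrA !subrK.
Qed.

End MatrixUnits.

Lemma relator_rmorph (R S : pzRingType) (f : {rmorphism R -> S})
  (x y z t : R) (x' y' z' t' : S) :
  f x = x' -> f y = y' -> f z = z' -> f t = t' ->
  f (jordan x y z - t) = jordan x' y' z' - t'.
Proof. by move=> <- <- <- <-; rewrite rmorphB rmorph_jordan. Qed.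

Lemma linear_comb2 (F : fieldType) (V W : lmodType F) (h : {linear V -> W})
  k l x y : h (k *: x + l *: y) = k *: h x + l *: h y.
Proof. by rewrite linearD !linearZ. Qed.

(** As a unital algebra morphism, [f] sends [a * b] and [b * a] to the two diagonal matrix units,
    and therefore [1 - a * b - b * a] to [(1, 0)]. *)
Lemma units_combK (F : fieldType) (A : algType F) (a b : A)
    (f : {lrmorphism A -> (F^o * 'M[F]_2)%type}) :
  f a = (0, delta_mx 0 1) -> f b = (0, delta_mx 1 0) ->
  cancel (units_comb a b) f.
Proof.
move=> fa fb p; rewrite /units_comb !linearD !linearZ /= !linearN.
rewrite !rmorphM rmorph1 fa fb.
case: p => k M; congr (_, _); rewrite /= fa fb /=.
  by rewrite !mulr0 !scaler0 !subr0 !addr0; apply: mulr1.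
rewrite -!mulmxE !mul_delta_mx.
apply: mx2P; rewrite !mxE /=.
all: by rewrite !(mulr0, mulr1, oppr0, subr0, subrr, addr0, add0r).
Qed.

(** * The isomorphism of the envelope with [F * 'M_2], and the resulting basis *)

Section EnvelopeSplit.
Variable F : fieldType.
Local Notation U := (envelope F).
Local Notation a := (env_a F).
Local Notation b := (env_b F).
Local Notation FM := (F^o * 'M[F]_2)%type.

(** The first component is the trivial representation, the second the natural one. *)
Definition letter_mx (i : 'I_2) : FM :=
  (0, if i == 0 then delta_mx 0 1 else delta_mx 1 0).

Definition free2_split : {lrmorphism free2 F -> FM} := free2_eval letter_mx.

Lemma free2_split_phi x : free2_split (phi x) = (0, zdval x).
Proof.
have ea : free2_split (fa F) = (0, delta_mx 0 1) := free2_evalU _ _.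
have eb : free2_split (fb F) = (0, delta_mx 1 0) := free2_evalU _ _.
have /zero_diagP x0 := zdvalP x.
have -> : free2_split (phi x) =
    zdval x 0 1 *: free2_split (fa F) + zdval x 1 0 *: free2_split (fb F).
  exact: linear_comb2.
rewrite ea eb.
congr (_, _); first by rewrite /= !scaler0 addr0.
by apply: mx2P; rewrite !mxE /= ?x0 ?mulr0 ?mulr1 ?addr0 ?add0r.
Qed.

(** The first component vanishes on every [phi x]. In the second, [phi x] becomes the matrix [x],
    and the operation on the zero-diagonal space is computed with these very matrices. *)
Lemma free2_split_relator x : env_relator x -> free2_split x = 0.
Proof.
case=> {}x y z _ _ _.
rewrite (relator_rmorph (free2_split_phi x) (free2_split_phi y)
  (free2_split_phi z) (free2_split_phi _)).
rewrite /jordan /=; congr (_, _); rewrite /= ?subrr //.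
by rewrite !mul0r addr0; apply: subr0.
Qed.

Definition env_split : U -> FM := env_lift free2_split.

HB.instance Definition _ := GRing.isLinear.Build F U FM *:%R
  env_split (env_lift_linear free2_split_relator).
HB.instance Definition _ := GRing.isMonoidMorphism.Build U FM
  env_split (env_lift_monoid_morphism free2_split_relator).

Lemma env_split_a : env_split a = (0, delta_mx 0 1).
Proof. exact: etrans (env_liftE free2_split_relator _) (free2_evalU _ _). Qed.

Lemma env_split_b : env_split b = (0, delta_mx 1 0).
Proof. exact: etrans (env_liftE free2_split_relator _) (free2_evalU _ _). Qed.

Definition env_unsplit : FM -> U := units_comb a b.
HB.instance Definition _ := GRing.Linear.on env_unsplit.

Lemma env_unsplitK : cancel env_unsplit env_split.
Proof.
move=> p; exact: (units_combK (f := env_split) env_split_a env_split_b).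
Qed.

Hypothesis charF : [pchar F] =i pred0.

Lemma env_aa : a * a = 0.
Proof.
by have [[? ? ?] _] := env_jordan_relations F; apply: (@jordan_xx F _ _ b).
Qed.

Lemma env_bb : b * b = 0.
Proof.
by have [_ [? ? ?]] := env_jordan_relations F; apply: (@jordan_xx F _ _ a).
Qed.

Lemma env_aba : a * b * a = a.
Proof.
by have [[? ? ?] _] := env_jordan_relations F; apply: (@jordan_xyx F).
Qed.

Lemma env_bab : b * a * b = b.
Proof.
by have [_ [? ? ?]] := env_jordan_relations F; apply: (@jordan_xyx F).
Qed.

(** This is the spanning half: the composite fixes [1] and commutes with left multiplication by
    either generator, hence is the identity. *)
Lemma env_splitK : cancel env_split env_unsplit.
Proof.
elim/envelope_ind => [|k x y IHx IHy|x IH|x IH].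
- by rewrite rmorph1; apply: units_comb1.
- by rewrite -[in RHS]IHx -[in RHS]IHy (linearP env_split); apply: linearP.
- have [Ea _] := units_comb_mull env_aa env_bb env_aba env_bab (env_split x).
  rewrite -[in RHS]IH; apply: etrans _ (esym Ea); congr env_unsplit.
  by rewrite -env_split_a; apply: rmorphM.
- have [_ Eb] := units_comb_mull env_aa env_bb env_aba env_bab (env_split x).
  rewrite -[in RHS]IH; apply: etrans _ (esym Eb); congr env_unsplit.
  by rewrite -env_split_b; apply: rmorphM.
Qed.

End EnvelopeSplit.

Lemma units_comb_basis (F : fieldType) (A : algType F) (a b : A)
    (f : A -> (F^o * 'M[F]_2)%type) :
  cancel f (units_comb a b) -> cancel (units_comb a b) f ->
  is_basis [tuple 1; a; b; a * b; b * a].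
Proof.
move=> fK gK.
(* [c 0] is added on the diagonal since [1] maps to [(1, 1%:M)]. *)
pose p (c : 'I_5 -> F) : F^o * 'M[F]_2 := (c (inord 0), \matrix_(i, j)
  if i == 0 then if j == 0 then c (inord 0) + c (inord 3) else c (inord 1)
  else if j == 0 then c (inord 2) else c (inord 0) + c (inord 4)).
have sumE (c : 'I_5 -> F) :
    \sum_i c i *: tnth [tuple 1; a; b; a * b; b * a] i = units_comb a b (p c).
  have E i : true -> c i *: tnth [tuple 1; a; b; a * b; b * a] i =
      c (inord i) *: [:: 1; a; b; a * b; b * a]`_i.
    by rewrite inord_val (tnth_nth 0).
  rewrite (eq_bigr _ E) !big_ord_recl big_ord0 /units_comb !mxE /= addr0.
  rewrite !scalerDl !scalerBr.
  (* [X] and [Y] are the multiples of [a * b] and [b * a] by the coefficient of [1]: subtracted with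
     the unit of [F], they return from the diagonal entries of [p c]. *)
  have V (P X Y Z Q R T : A) :
      P + (Q + (R + (Z + T))) = P - X - Y + (X + Z + Q + (R + (Y + T))).
    rewrite -(addrA X) [R + (Y + T)]addrCA [X + _ + _]addrACA [RHS]addrA.
    rewrite -(addrA P) -opprD subrK; congr (_ + _).
    by rewrite [Z + Q]addrC -addrA [R + (Z + T)]addrCA.
  exact: V.
split=> [c|u].
  rewrite sumE => c0.
  have {c0} : p c = 0 by apply: (can_inj gK); rewrite c0 linear0.
  case=> c0 /matrixP Mc i; rewrite -(inord_val i).
  have := (Mc 0 0, Mc 0 1, Mc 1 0, Mc 1 1); rewrite !mxE /= c0 !add0r.
  by case=> [[[c3 c1] c2] c4]; case: i => [[|[|[|[|[|//]]]]]] ?.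
(* These coefficients invert [p]: the share of [1] is removed from the diagonal entries. *)
exists (fun i => let (k, N) := f u in
  [:: k; N 0 1; N 1 0; N 0 0 - k; N 1 1 - k]`_i).
rewrite sumE -[LHS]fK; congr units_comb; case: (f u) => k N.
rewrite /p !inordK //=; congr (_, _).
by apply: mx2P; rewrite !mxE /= ?[k + _]addrC ?subrK.
Qed.

(** * Ideals of matrix algebras and Schur's lemma *)

Lemma matrix_ideal_full (F : fieldType) (n : nat) (K : 'M[F]_n.+1 -> Prop) :
  K 0 ->
  (forall k M N, K M -> K N -> K (k *: M + N)) ->
  (forall M N, K N -> K (M * N) /\ K (N * M)) ->
  forall M N, K M -> M != 0 -> K N.
Proof.
move=> K0 KD KM M N KMM /matrix0Pn[i [j Mij]].
(* A single nonzero entry yields every matrix unit, since [E_pi M E_jq = M_ij E_pq]. *)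
have -> : N = \sum_p \sum_q
    (N p q / M i j) *: (delta_mx p i *m M *m delta_mx j q).
  rewrite {1}[N]matrix_sum_delta; apply: eq_bigr => p _; apply: eq_bigr => q _.
  (* Each outer factor is split as a column times a row, which isolates the entry [M i j] as a 1 by
     1 matrix in the middle. *)
  rewrite -(mul_delta_mx (0 : 'I_1) p i) -(mul_delta_mx (0 : 'I_1) j q).
  rewrite !mulmxA -[_ *m delta_mx 0 i *m M]mulmxA -rowE.
  rewrite -[_ *m delta_mx j 0]mulmxA -colE [col j _]mx11_scalar !mxE.
  by rewrite mul_mx_scalar -scalemxAl mul_delta_mx scalerA divfK.
have Ksum (I : finType) (G : I -> 'M[F]_n.+1) :
    (forall x, K (G x)) -> K (\sum_x G x).
  move=> KG; elim/big_ind: _ => // x y Kx Ky; rewrite -[x]scale1r; exact: KD.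
apply: (Ksum) => p; apply: (Ksum) => q; rewrite -[_ *: _]addr0; apply: KD => //.
have [+ _] := KM (delta_mx p i) M KMM; rewrite -mulmxE => KpM.
by have [_] := KM (delta_mx j q) _ KpM.
Qed.

Section Schur.
Variables (F : fieldType) (A : algType F) (V W : vectType F).
Variables (rho : {linear A -> 'End(V)}) (sigma : {linear A -> 'End(W)}).

(** The kernel and image of [h] are invariant, so irreducibility makes [h] bijective. The conclusion
    uses the inverse of [h], because [h] will map a known model into an arbitrary representation
    that is to be compared with it. *)
Lemma schur_iso (h : 'Hom(V, W)) :
  irreducible rho -> irreducible sigma ->
  (forall x v, h (rho x v) = sigma x (h v)) -> h != 0 ->
  isomorphic_reps sigma rho.
Proof.
move=> [_ irrV] [_ irrW] hC h0.
have kerP x : (rho x @: lker h <= lker h)%VS.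
  apply/subvP => _ /memv_imgP[v + ->].
  by rewrite !memv_ker hC => /eqP->; rewrite linear0.
have imgP x : (sigma x @: limg h <= limg h)%VS.
  apply/subvP => _ /memv_imgP[_ /memv_imgP[v _ ->] ->].
  by rewrite -hC memv_img ?memvf.
have ker0 : lker h == 0%VS.
  have [-> //|kerT] := irrV _ kerP.
  case/eqP: h0; apply/lfunP => v; rewrite lfunE /=; apply/eqP.
  by rewrite -memv_ker kerT memvf.
have imgT : limg h = fullv.
  have [img0|//] := irrW _ imgP.
  case/eqP: h0; apply/lfunP => v; rewrite lfunE /=; apply/eqP.
  by rewrite -memv0 -img0 memv_img ?memvf.
have hK : cancel h h^-1%VF by apply: lker0_lfunK.
have hVK : cancel h^-1%VF h by move=> w; apply: limg_lfunVK; rewrite imgT memvf.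
exists h^-1%VF; split; first by exists h.
by move=> x w; rewrite -{1}[w]hVK -hC hK.
Qed.

End Schur.

(** * Ideals and representations of an algebra isomorphic to [F * 'M_n.+1] *)

Section ScalarMatrixAlgebra.
Variables (F : fieldType) (n : nat) (A : algType F).
Local Notation FM := (F^o * 'M[F]_n.+1)%type.
Variables (f : {lrmorphism A -> FM}) (g : {linear FM -> A}).
Hypotheses (fK : cancel f g) (gK : cancel g f).

Let gM p q : g (p * q) = g p * g q.
Proof. by apply: (can_inj fK); rewrite rmorphM /= !gK. Qed.

Let ker2E x : (f x).2 = 0 -> x = g ((f x).1, 0).
Proof. by rewrite -{2}(fK x); case: (f x) => k M /= ->. Qed.

Let ker1E x : (f x).1 = 0 -> x = g (0, (f x).2).
Proof. by rewrite -{2}(fK x); case: (f x) => k M /= ->. Qed.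

(** The component is a line, so a nonzero subspace fills it; its product is nonzero because
    [g (1, 0)] is idempotent. *)
Lemma scalar_component_simple : simple_ideal (fun x => (f x).2 = 0).
Proof.
split=> [||K KJ K0 KD KM]; first exact: (is_ideal_ker (snd \o f)).
  exists (g (1, 0)), (g (1, 0)); rewrite !gK; split=> // /(congr1 f).
  by rewrite -gM gK rmorph0 => -[/eqP]; rewrite mulr1 oner_eq0.
have [[x [Kx /eqP x0]]|Kn0] := pselect (exists x, K x /\ x <> 0); last first.
  by left=> x Kx; apply: contrapT => x0; apply: Kn0; exists x.
right=> y /ker2E->; have xE := ker2E (KJ x Kx).
have k0 : (f x).1 != 0 :> F.
  by apply: contra x0 => /eqP k0; rewrite xE k0 -(linear0 g).
have -> : g ((f y).1, 0) = ((f y).1 / (f x).1 : F) *: x + 0.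
  rewrite {2}xE addr0 -linearZ; congr (g (_, _)); last by rewrite scaler0.
  by rewrite /= /GRing.scale /= divfK.
exact: KD.
Qed.

Lemma matrix_component_simple : simple_ideal (fun x => (f x).1 = 0).
Proof.
split=> [||K KJ K0 KD KM]; first exact: (is_ideal_ker (fst \o f)).
  exists (g (0, 1)), (g (0, 1)); rewrite !gK; split=> // /(congr1 f).
  by rewrite -gM gK rmorph0 => -[_ /eqP]; rewrite mulr1 oner_eq0.
have [[x [Kx /eqP x0]]|Kn0] := pselect (exists x, K x /\ x <> 0); last first.
  by left=> x Kx; apply: contrapT => x0; apply: Kn0; exists x.
right=> y /ker1E->; have xE := ker1E (KJ x Kx).
(* [K] is transported to a two-sided ideal of matrices, nonzero because it contains [(f x).2]. *)
apply: (@matrix_ideal_full F n (fun M => K (g (0, M))) _ _ _ (f x).2).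
- by rewrite (linear0 g).
- move=> k M N KgM KgN; have := KD k _ _ KgM KgN.
  by rewrite -linearP; congr (K (g (_, _))); rewrite /= scaler0 addr0.
- move=> M N KgN; have [] := KM (g (0, M)) _ _ KgN; first by rewrite gK.
  have E P Q : g (0, P) * g (0, Q) = g (0, P * Q).
    by rewrite -gM; congr (g (_, _)); apply: mulr0.
  by rewrite !E.
- by rewrite -xE.
- by apply: contra x0 => /eqP M0; rewrite xE M0 (linear0 g).
Qed.

Lemma component_direct_sum :
  direct_sum_decomposition (fun x => (f x).2 = 0) (fun x => (f x).1 = 0).
Proof.
split=> [x|x x2 x1].
  exists (g ((f x).1, 0)), (g (0, (f x).2)); rewrite !gK; split=> //.
  rewrite -linearD -[LHS]fK; apply: (congr1 g); case: (f x) => k M.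
  by congr (_, _); rewrite /= ?addr0 ?add0r.
by rewrite (ker1E x1) x2 (linear0 g).
Qed.

Definition scalar_rep (x : A) : 'End(F^o) := (f x).1 *: \1%VF.

Lemma scalar_rep_linear : linear scalar_rep.
Proof. by move=> k x y; rewrite /scalar_rep linearP /= scalerDl scalerA. Qed.
HB.instance Definition _ :=
  GRing.isLinear.Build F A 'End(F^o) *:%R scalar_rep scalar_rep_linear.

Lemma scalar_rep_representation : is_representation scalar_rep.
Proof.
split=> [|x y]; rewrite /= /scalar_rep; first by rewrite rmorph1 scale1r.
apply/lfunP => v; rewrite rmorphM comp_lfunE !scale_lfunE !id_lfunE.
by rewrite scalerA.
Qed.

Lemma scalar_rep_irreducible : irreducible scalar_rep.
Proof.
split=> [|W _].
  by rewrite -dimv_eq0 dimvf /dim /=.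
have [->|W0] := eqVneq W 0%VS; [by left | right].
apply/eqP; rewrite eqEsubv subvf /=; apply/subvP => v _.
have w0 : vpick W != 0 by rewrite vpick0.
rewrite -[v](divfK w0); apply: (memvZ (v / vpick W : F) (memv_pick W)).
Qed.

Definition matrix_rep (x : A) : 'End('cV[F]_n.+1) := linfun (mulmx (f x).2).

Lemma matrix_repE x c : matrix_rep x c = (f x).2 *m c.
Proof. by rewrite lfunE. Qed.

Lemma matrix_rep_linear : linear matrix_rep.
Proof.
move=> k x y; apply/lfunP => c.
rewrite add_lfunE scale_lfunE !matrix_repE linearP /=.
by rewrite mulmxDl scalemxAl.
Qed.
HB.instance Definition _ :=
  GRing.isLinear.Build F A 'End('cV[F]_n.+1) *:%R matrix_rep matrix_rep_linear.

Lemma matrix_rep_representation : is_representation matrix_rep.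
Proof.
split=> [|x y]; apply/lfunP => c.
  by rewrite matrix_repE rmorph1 mul1mx id_lfunE.
by rewrite comp_lfunE !matrix_repE rmorphM mulmxA.
Qed.

Lemma matrix_rep_irreducible : irreducible matrix_rep.
Proof.
split=> [|W WP].
  by rewrite -dimv_eq0 dimvf /dim /=.
have [->|W0] := eqVneq W 0%VS; [by left | right].
apply/eqP; rewrite eqEsubv subvf /=; apply/subvP => v _.
have /matrix0Pn[i [j]] : vpick W != 0 by rewrite vpick0.
rewrite (ord1 j) => wi0; pose w := vpick W.
(* This rank-one matrix reads off the nonzero entry [w i 0], normalizes it and returns [v]; so any
   nonzero vector generates the whole space. *)
pose M := (w i 0)^-1 *: (v *m delta_mx 0 i).
have -> : v = matrix_rep (g (0, M)) w.
  rewrite matrix_repE gK /= -scalemxAl -mulmxA -rowE [row i w]mx11_scalar !mxE.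
  by rewrite mul_mx_scalar scalerA mulVf ?scale1r.
by apply: (subvP (WP (g (0, M)))); apply: memv_img; apply: memv_pick.
Qed.

(** * Classification of the irreducible representations *)

Section Classification.
Variables (V : vectType F) (rho : {linear A -> 'End(V)}).
Hypotheses (rhoP : is_representation rho) (rho_irr : irreducible rho).

Let rhoM x y v : rho (x * y) v = rho x (rho y v).
Proof. by rewrite rhoP.2 comp_lfunE. Qed.

(** Left multiplication of [c *m r] by a matrix affects only the column, so with [r] and [v] fixed
    the map from columns to [V] intertwines the two actions. *)
Lemma irreducible_matrix_rep (r : 'rV[F]_n.+1) (c : 'cV[F]_n.+1) (v : V) :
  rho (g (0, c *m r)) v <> 0 -> isomorphic_reps rho matrix_rep.
Proof.
pose h c := rho (g (0, c *m r)) v.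
have h_linear : linear h.
  move=> k c1 c2; rewrite /h -scale_lfunE -add_lfunE -!linearP.
  congr (rho (g (_, _)) _); first by rewrite /= scaler0 addr0.
  by rewrite /= mulmxDl -scalemxAl.
pose hL := GRing.isLinear.Build _ _ _ _ h h_linear.
pose hl : {linear 'cV[F]_n.+1 -> V} := HB.pack h hL.
have hE d : linfun hl d = h d := lfunE _ _.
move=> hc; apply: (schur_iso (h := linfun hl)) => //.
- exact: matrix_rep_irreducible.
- move=> x d; rewrite !hE matrix_repE /h -rhoM.
  congr (rho _ _); apply: (can_inj fK); rewrite rmorphM /= !gK -mulmxA.
  by congr (_, _); apply/esym; apply: mulr0.
- by apply/negP => /eqP/lfunP/(_ c); rewrite hE lfunE.
Qed.

Lemma irreducible_scalar_or_matrix_rep :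
  isomorphic_reps rho scalar_rep \/ isomorphic_reps rho matrix_rep.
Proof.
have [[r [c [v rcv]]]|rc0] :=
  pselect (exists (r : 'rV_n.+1) c v, rho (g (0, c *m r)) v <> 0).
  by right; apply: irreducible_matrix_rep rcv.
(* The identity matrix is a sum of products of a column and a row, each of which acts by 0. *)
left; have rho1 : rho (g (0, 1)) = 0.
  have -> : (0, 1) = \sum_i (0, delta_mx i 0 *m delta_mx (0 : 'I_1) i) :> FM.
    have -> : 1 = \sum_i delta_mx i 0 *m delta_mx (0 : 'I_1) i :> 'M[F]_n.+1.
      rewrite -[1]/(1%:M) scalar_mx_sum_delta.
      by apply: eq_bigr => i _; rewrite scale1r mul_delta_mx.
    by elim/big_rec2: _ => // i p M _ <-; congr (_, _); rewrite addr0.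
  rewrite !linear_sum big1 // => i _; apply/lfunP => v; rewrite lfunE /=.
  by apply: contrapT => ?; apply: rc0; do 3!eexists; eassumption.
have rhoE x v : rho x v = (f x).1 *: v.
  (* In coordinates this reads [(k, M) = (k, k) + (0, M) - (0, k)]; the last two terms act by 0. *)
  have xE : x = (f x).1 *: 1 + x * g (0, 1) - (f x).1 *: g (0, 1).
    apply: (can_inj fK).
    rewrite linearB linearD !linearZ rmorphM rmorph1 /= !gK.
    case: (f x) => k M; congr (_, _) => /=.
      by rewrite mulr0 oppr0 scaler0 !addr0; apply/esym; apply: mulr1.
    by rewrite mulr1 scalerN addrAC subrr add0r.
  rewrite [in LHS]xE linearB linearD !linearZ /= rhoP.1 rhoP.2 rho1.
  rewrite comp_lfun0r oppr0 scaler0 !addr0.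
  by rewrite scale_lfunE id_lfunE.
have [V0 _] := rho_irr.
(* Since the algebra acts by scalars, the line through any nonzero vector is invariant; [h]
   parametrizes it. *)
pose v := vpick (fullv : {vspace V}).
have v0 : v != 0 by rewrite vpick0.
pose h (k : F^o) := k *: v.
have h_linear : linear h by move=> k x y; rewrite /h scalerDl scalerA.
pose hL := GRing.isLinear.Build _ _ _ _ h h_linear.
pose hl : {linear F^o -> V} := HB.pack h hL.
apply: (schur_iso (h := linfun hl)) => //.
- exact: scalar_rep_irreducible.
- by move=> x k; rewrite rhoE !lfunE /= /h lfunE /= scalerA.
- by apply/negP => /eqP/lfunP/(_ 1); rewrite !lfunE /= /h scale1r; apply/eqP.
Qed.

End Classification.

End ScalarMatrixAlgebra.

Theorem theorem5p1 (F : fieldType) (charF : [pchar F] =i pred0) :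
  let U := envelope F in
  let a : U := env_a F in
  let b : U := env_b F in
  [/\ is_basis [tuple 1; a; b; a * b; b * a],
      ([/\ a * a = 0, a * b = a * b, a * (a * b) = 0 & a * (b * a) = a]
       /\ [/\ b * a = b * a, b * b = 0, b * (a * b) = b & b * (b * a) = 0])
      /\
      ([/\ (a * b) * a = a, (a * b) * b = 0,
           (a * b) * (a * b) = a * b & (a * b) * (b * a) = 0]
       /\ [/\ (b * a) * a = 0, (b * a) * b = b,
              (b * a) * (a * b) = 0 & (b * a) * (b * a) = b * a]),
      exists f : {lrmorphism U -> (F^o * 'M[F]_2)%type},
        let J1 (u : U) := (f u).2 = 0 in
        let J2 (u : U) := (f u).1 = 0 in
        [/\ bijective f, simple_ideal J1, simple_ideal J2
          & direct_sum_decomposition J1 J2]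
    & exists (triv : {linear U -> 'End(F^o)})
             (nat_rep : {linear U -> 'End('cV[F]_2)}),
        [/\ [/\ is_representation triv, triv a = 0, triv b = 0
              & irreducible triv],
            [/\ is_representation nat_rep,
                nat_rep a = linfun (mulmx (zdval (e1 F))),
                nat_rep b = linfun (mulmx (zdval (e2 F)))
              & irreducible nat_rep]
          & forall (V : vectType F) (rho : {linear U -> 'End(V)}),
              is_representation rho -> irreducible rho ->
              isomorphic_reps rho triv \/ isomorphic_reps rho nat_rep]].
Proof.
move=> U a b.
pose f : {lrmorphism U -> (F^o * 'M[F]_2)%type} := @env_split F.
pose g : {linear (F^o * 'M[F]_2)%type -> U} := @env_unsplit F.
have fK : cancel f g := env_splitK charF.
have gK : cancel g f := @env_unsplitK F.
have fa : f a = (0, delta_mx 0 1) := env_split_a F.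
have fb : f b = (0, delta_mx 1 0) := env_split_b F.
have aa := env_aa charF; have bb := env_bb charF.
have aba := env_aba charF; have bab := env_bab charF.
split.
- exact: units_comb_basis fK gK.
- split; first exact: letter_mulE.
  exact: word2_mulE.
- exists f; split; first by exists g.
  + exact: scalar_component_simple fK gK.
  + exact: matrix_component_simple fK gK.
  + exact: component_direct_sum fK gK.
(* The two representations are the coordinates of [f], whose values at [a] and [b] are [(0, e1)] and
   [(0, e2)]. *)
exists (scalar_rep f), (matrix_rep f); split.
- split; first exact: scalar_rep_representation.
  + by rewrite /= /scalar_rep fa scale0r.
  + by rewrite /= /scalar_rep fb scale0r.
  + exact: scalar_rep_irreducible.
- split; first exact: matrix_rep_representation.
  + by rewrite /= /matrix_rep fa.
  + by rewrite /= /matrix_rep fb.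
  + exact: matrix_rep_irreducible gK.
move=> V rho rhoP rho_irr.
exact: (irreducible_scalar_or_matrix_rep fK gK rhoP rho_irr).
Qed.
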